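(* Every one-pass randomized streaming algorithm for the matching parenthesis problem $\mathrm{DYCK}(2)$ on words of length $n'$ with (two-sided) error $O\!\left(\frac{1}{n'\log n'}\right)$ uses $\Omega(\sqrt{n'\log n'})$ space.
   Context: $\mathrm{DYCK}(2)$ is the language of well-parenthesized words with two types of parentheses: over the alphabet $\{a,\bar a,b,\bar b\}$ it is the smallest language $L$ satisfying $L=\{\epsilon\}\cup aL\bar aL\cup bL\bar bL$ ($a,b$ are opening parentheses, and $\bar a,\bar b$ the respective closing ones). $\mathrm{DYCK}(2)$ also denotes the problem of deciding whether a given word is in the language. A one-pass randomized streaming algorithm with space $s(n')$ reads the input stream $x_1,\ldots,x_{n'}$ letter by letter, once, in this order, while maintaining a memory space of size $s(n')$, and may use random coins; the length $n'$ is given in advance. Two-sided error $\varepsilon$ means that on every word of length $n'$, whether or not it is in the language, the decision is wrong with probability at most $\varepsilon$ over the coins.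
   Formalization: The space bound is stated for even n' tending to infinity only: no word of odd length n' is in DYCK(2), so for odd n' the algorithm that always rejects uses no memory and never errs, and the claim over all n' would be false. *)

(* Defs.v *)
From mathcomp Require Import all_boot all_order all_algebra.
From mathcomp Require Import all_classical all_reals all_analysis.

Set Implicit Arguments.
Unset Strict Implicit.
Unset Printing Implicit Defensive.

Local Open Scope classical_set_scope.
Local Open Scope ring_scope.

Inductive letter : Type := open_a | close_a | open_b | close_b.

(* Smallest L with L = {eps} \cup a L abar L \cup b L bbar L. *)
Inductive dyck2 : seq letter -> Prop :=
| dyck2_nil : dyck2 [::]
| dyck2_a u v : dyck2 u -> dyck2 v ->
    dyck2 (open_a :: u ++ close_a :: v)
| dyck2_b u v : dyck2 u -> dyck2 v ->
    dyck2 (open_b :: u ++ close_b :: v).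

(* A randomized one-pass algorithm with s bits of memory, for one fixed input
   length (nothing relates the algorithms used for different lengths).
   The coins are a point of an arbitrary probability space.  Every step may
   consult the coins and the position of the letter being read, and neither is
   charged to the memory; only the s bits carry information about the letters
   read before.  Algorithms that toss fresh coins at each step (take a product
   space, step i looking only at its i-th component), that keep in memory the
   coins they reuse, or that count positions in memory, are special cases. *)
Record stream_alg (R : realType) (s : nat) := StreamAlg {
  coin_display : measure_display;
  coins : measurableType coin_display;
  coin_law : probability coins R;
  init : coins -> s.-tuple bool;
  step : coins -> nat -> s.-tuple bool -> letter -> s.-tuple bool;
  accept : coins -> s.-tuple bool -> bool;
  measurable_init : forall q, measurable [set w | init w = q];
  measurable_step : forall i q a r, measurable [set w | step w i q a = r];
  measurable_accept : forall q, measurable [set w | accept w q]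
}.

(* Memory after reading x from memory q, the first letter of x being at
   position i. *)
Fixpoint run (R : realType) (s : nat) (A : stream_alg R s) (w : coins A)
    (i : nat) (q : s.-tuple bool) (x : seq letter) : s.-tuple bool :=
  if x is a :: x' then run w i.+1 (step w i q a) x' else q.

Definition decision (R : realType) (s : nat) (A : stream_alg R s)
    (w : coins A) (x : seq letter) : bool :=
  accept w (run w 0 (init w) x).

Definition dyck2_error_le (R : realType) (s : nat) (A : stream_alg R s)
    (n : nat) (eps : R) : Prop :=
  forall x : n.-tuple letter,
    (coin_law A [set w | ~ (decision w x <-> dyck2 x)] <= eps%:E)%E.

(* Main.v *)
Require Import Defs.
From mathcomp Require Import all_boot all_order all_algebra zify ring lra.
From mathcomp Require Import all_classical all_reals all_analysis measurable_realfun.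

Import Order.TTheory GRing.Theory Num.Theory.
Import numFieldNormedType.Exports.

(** An input pushes words [x_0, .., x_(m-1)] of length [n] on the stack, and
    between two of them pops the top [k + 1] letters of the last one, claims
    their values, and pushes them back; at the end everything is popped.
    Averaging over the coins leaves a deterministic algorithm with few errors.

    When [x_i] has been pushed, a memory of fewer than [c n] bits leaves most
    letters of [x_i] undetermined, even given the letters above them.  So the
    last pop must rely on what the memory retains of the claims.  Suppose two
    correct inputs with the same words agree before cut [i], have cuts [k' < k]
    there, and reach the same final memory.  Change letter [k] of [x_i], and
    possibly deeper ones, without the memory noticing: the claim at [k] becomes
    wrong and the claim at [k'] stays right, yet the final memory and the
    remaining input are the same for both, so one of the answers is an error.
    Hence, given the words and the final memory, the cuts at undetermined
    letters can be recovered one by one, and [2 ^ s] is at least about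
    [n ^ (m / 2)].  Words and cuts are uniform; resampling a word given the
    memory and its top letters preserves this law, and a union bound over the
    [m n] pairs (word, cut) is where the error has to be [O(1 / (N log N))].
    Take [m n] of order [N] and [n] of order [m log N]. *)

Set Implicit Arguments.
Unset Strict Implicit.
Unset Printing Implicit Defensive.

(** * Strings undetermined by a small memory *)

Lemma sum_tuple_cons (M : nmodType) n (F : seq bool -> M) :
  (\sum_(x : n.+1.-tuple bool) F x =
   \sum_(b : bool) \sum_(x : n.-tuple bool) F (b :: x))%R.
Proof.
rewrite pair_big /=.
rewrite (reindex (fun p : bool * n.-tuple bool => [tuple of p.1 :: p.2])) //=.
exists (fun x : n.+1.-tuple bool => (thead x, [tuple of behead x])).
  by move=> [b x] _ /=; congr (_, _); apply: val_inj.
by move=> x _; apply: val_inj => /=; case: x => -[].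
Qed.

Definition pcount n (P : pred (seq bool)) : nat := \sum_(x : n.-tuple bool) P x.

Lemma pcountS n P : pcount n.+1 P = \sum_(b : bool) pcount n (fun x => P (b :: x)).
Proof. exact: (@sum_tuple_cons nat n (fun x => P x : nat)). Qed.

Lemma eq_pcount n (P P' : pred (seq bool)) :
  (forall x : n.-tuple bool, P x = P' x) -> pcount n P = pcount n P'.
Proof. by move=> e; apply: eq_bigr => x _; rewrite e. Qed.

Definition cyl (P : pred (seq bool)) k (x : seq bool) : pred (seq bool) :=
  fun z => P z && (take k z == take k x).

Definition flipped (k : nat) (x z : seq bool) : bool :=
  nth false z k != nth false x k.

(** With [P] a fiber of the memory map, a rigid letter is one that the memory and the letters above
    it nearly determine. *)
Definition rigid n P k x : bool :=
  16 * pcount n (fun z => cyl P k x z && flipped k x z) < pcount n (cyl P k x).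

Definition nb_rigid n P x : nat := \sum_(k < n) rigid n P k x.

Lemma pcount_cyl_cons n P k b x (Q : pred (seq bool)) :
  pcount n.+1 (fun z => cyl P k.+1 (b :: x) z && Q z) =
  pcount n (fun z => cyl (fun y => P (b :: y)) k x z && Q (b :: z)).
Proof.
rewrite pcountS (bigD1 b) //= [X in (_ + X)%N]big1 ?addn0.
  apply: eq_bigr => z _; rewrite /cyl /= eqseq_cons eqxx /=; done.
move=> b' bb'; apply: big1 => z _.
by rewrite /cyl /= eqseq_cons (negPf bb') /= andbF.
Qed.

Lemma rigid_cons n P k b x :
  rigid n.+1 P k.+1 (b :: x) = rigid n (fun y => P (b :: y)) k x.
Proof.
rewrite /rigid pcount_cyl_cons /flipped /=.
congr (_ < _).
rewrite (eq_pcount (P' := fun z => cyl P k.+1 (b :: x) z && true)); last first.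
  by move=> z; rewrite andbT.
by rewrite pcount_cyl_cons; apply: eq_pcount => z; rewrite andbT.
Qed.

(** Recursion along the tree of prefixes: only the first letter compares the two subtrees, all later
    ones live inside the subtree of [b]. *)
Lemma nb_rigid_cons n P b x :
  nb_rigid n.+1 P (b :: x) =
  ((16 * pcount n (fun y => P (~~ b :: y)) < pcount n.+1 P) +
   nb_rigid n (fun y => P (b :: y)) x)%N.
Proof.
rewrite /nb_rigid big_ord_recl; congr (_ + _)%N; last first.
  by apply: eq_bigr => k _; rewrite lift0 rigid_cons.
congr (nat_of_bool (_ * _ < _)); last first.
  by apply: eq_pcount => z; rewrite /cyl !take0 eqxx andbT.
rewrite pcountS (bigD1 (~~ b)) //= [X in (_ + X)%N]big1 ?addn0.
  apply: eq_bigr => z _; rewrite /cyl /flipped /= eqxx andbT.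
  by rewrite [~~ b == b](_ : _ = false) ?andbT //; case: b.
move=> b' bb'; apply: big1 => z _.
by rewrite /flipped /=; have -> : b' = b; [case: b b' bb' => [] [] | rewrite eqxx andbF].
Qed.

Section Rigid.
Variable R : realFieldType.
Local Open Scope ring_scope.

Lemma rigid_step_ge (a b u v : R) :
  a ^+ 2 <= u -> b ^+ 2 <= v -> 0 <= u -> 0 <= v -> v <= u / 15 ->
  (9 / 8 * a + b) ^+ 2 <= 2 * (u + v).
Proof.
move=> au bv u0 v0 vu.
(* AM-GM: [2 (9/8 a) b <= (9/8 a)^2 / 4 + 4 b^2]. *)
have := sqr_ge0 (9 / 16 * a - 2 * b); nra.
Qed.

(* At a rigid node of the tree of prefixes, the two subtrees have sizes [u] and
   [v <= u / 15], so [sqrt u + sqrt v] falls short of [sqrt (2 (u + v))] by a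
   constant factor, which pays for the weight [9 / 8]. *)
Lemma sum_expr_nb_rigid n (P : pred (seq bool)) :
  (\sum_(x : n.-tuple bool | P x) (9 / 8) ^+ nb_rigid n P x) ^+ 2
  <= ((pcount n P) * 2 ^ n)%N%:R :> R.
Proof.
elim: n P => [|n IH] P.
  have e0 (x : 0.-tuple bool) : predT x = pred1 [tuple] x.
    by apply/esym/eqP; rewrite tuple0.
  by rewrite /pcount big_mkcond !(big_pred1 [tuple] e0) /nb_rigid big_ord0 /=;
    case: (P _); rewrite ?expr1n ?expr0n.
pose S b := \sum_(x : n.-tuple bool | P (b :: x))
   (9 / 8) ^+ nb_rigid n (fun y => P (b :: y)) x : R.
pose c b : R := (pcount n (fun y => P (b :: y)))%:R.
have S2 b : S b ^+ 2 <= c b * 2 ^+ n by rewrite -natrX -natrM; exact: IH.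
have c0 b : 0 <= c b * 2 ^+ n by rewrite mulr_ge0 ?exprn_ge0 ?ler0n.
have S0 b : 0 <= S b by apply: sumr_ge0 => x _; rewrite exprn_ge0 //; lra.
pose t b : bool := (16 * pcount n (fun y => P (~~ b :: y)) < pcount n.+1 P)%N.
have -> : \sum_(x : n.+1.-tuple bool | P x) (9 / 8) ^+ nb_rigid n.+1 P x =
   (9 / 8) ^+ t true * S true + (9 / 8) ^+ t false * S false :> R.
  rewrite big_mkcond /=.
  rewrite (@sum_tuple_cons _ _ (fun x => if P x then (9 / 8) ^+ nb_rigid n.+1 P x else 0)).
  rewrite big_bool /= -!big_mkcond /= /S !mulr_sumr.
  by congr (_ + _); apply: eq_bigr => x _; rewrite nb_rigid_cons exprD.
rewrite natrM natrX [2 ^+ n.+1]exprSr.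
have -> : (pcount n.+1 P)%:R = c true + c false :> R.
  by rewrite pcountS big_bool natrD.
have tE b : t b = (16 * c (~~ b) < c true + c false).
  by rewrite /t pcountS big_bool /= -(ltr_nat R) natrM natrD.
have p0 : 0 <= 2 ^+ n :> R by rewrite exprn_ge0.
have {}tE b : t b -> c (~~ b) * 2 ^+ n <= c b * 2 ^+ n / 15.
  rewrite tE => h; rewrite mulrAC ler_wpM2r //.
  by case: b h => /=; lra.
have -> : (c true + c false) * (2 ^+ n * 2) = 2 * (c true * 2 ^+ n + c false * 2 ^+ n).
  by ring.
have := S2 true; have := S2 false; have := c0 true; have := c0 false.
have := tE true; have := tE false; rewrite /=.
have := S0 true; have := S0 false.
move: (S true) (S false) => a b.
move: (c true * 2 ^+ n) (c false * 2 ^+ n) => u v a0 b0.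
case: (t true); case: (t false); rewrite ?expr1 ?expr0 ?mul1r => h1 h2.
(* Each of [u] and [v] is at most 1/15 of the other, so both vanish. *)
- have := h1 isT; have := h2 isT => ? ? v0 u0 hb ha.
  by have := sqr_ge0 (a - b); nra.
- by have := h2 isT => ? v0 u0 hb ha; apply: rigid_step_ge.
- have := h1 isT => ? v0 u0 hb ha.
  by rewrite [a + _]addrC [u + v]addrC; apply: rigid_step_ge.
- move=> v0 u0 hb ha.
  by have := sqr_ge0 (a - b); nra.
Qed.
End Rigid.

(** Cauchy-Schwarz, by expanding the sum of the squares of [#|I| * t i - S]. *)
Lemma sqr_sum_le_card (R : realFieldType) (I : finType) (t : I -> R) :
  ((\sum_i t i) ^+ 2 <= #|I|%:R * \sum_i t i ^+ 2)%R.
Proof.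
have [I0|I0] := posnP #|I|.
  by rewrite I0 mul0r big_pred0 ?expr0n // => i; have := fintype0 i I0.
set S := (\sum_i t i)%R.
have c0 : (0 < #|I|%:R :> R)%R by rewrite ltr0n.
have : (0 <= \sum_i (#|I|%:R * t i - S) ^+ 2)%R by apply: sumr_ge0 => i _; exact: sqr_ge0.
rewrite (eq_bigr (fun i => #|I|%:R ^+ 2 * t i ^+ 2 - 2 * #|I|%:R * S * t i + S ^+ 2)%R); last first.
  by move=> i _; ring.
rewrite !big_split /= sumrN -!mulr_sumr -/S [X in (_ + X)%R](_ : _ = #|I|%:R * S ^+ 2)%R; last first.
  by rewrite sumr_const mulr_natl mulrnAr.
set c : R := (#|I|%:R)%R in c0 *.
move=> h; rewrite -subr_ge0 -(pmulr_rge0 _ c0); apply: le_trans h _.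
by rewrite le_eqVlt; apply/orP; left; apply/eqP; ring.
Qed.

(** An exponential Markov inequality. Cauchy-Schwarz over the at most [2 ^ s] fibers bounds the sum
    of [(9 / 8) ^ u x] by [2 ^ (s / 2) * 2 ^ n]. Hence at most 1/32 of the strings have more than
    [T] rigid letters, and the others have at most [T = n / 32]. *)
Lemma sum_rigid_le (Q : finType) (f : seq bool -> Q) s T n :
  #|Q| <= 2 ^ s -> 4 * s + 40 <= T -> n = 32 * T ->
  16 * \sum_(x : n.-tuple bool) nb_rigid n (fun z => f z == f x) x <= 2 ^ n * n.
Proof.
move=> Qs sT nT.
pose u (x : n.-tuple bool) := nb_rigid n (fun z => f z == f x) x.
pose B := #|[pred x | T < u x]|.
have B32 : 32 * B <= 2 ^ n.
  have [l [l1 l8 Sle]] : exists l : rat, [/\ (1 <= l)%R, (2 <= l ^+ 8)%R &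
      ((\sum_x l ^+ u x) ^+ 2 <= (2 ^ s * (2 ^ n * 2 ^ n))%:R)%R].
    exists (9 / 8)%R; split; [lra | lra |].
    rewrite (partition_big (fun x : n.-tuple bool => f x) predT); last by [].
    apply: le_trans (sqr_sum_le_card _) _.
    rewrite natrM; apply: ler_pM; rewrite ?ler0n ?ler_nat //.
      by apply: sumr_ge0 => i _; exact: sqr_ge0.
    have -> : 2 ^ n * 2 ^ n = \sum_q (pcount n (fun x => f x == q) * 2 ^ n).
      rewrite -big_distrl /= /pcount exchange_big /=; congr (_ * _).
      rewrite (eq_bigr (fun _ => 1)) ?sum1_card ?card_tuple ?card_bool // => x _.
      rewrite (bigD1 (f x)) //= eqxx big1 // => q /negPf.
      by rewrite eq_sym => ->.
    rewrite natr_sum; apply: ler_sum => q _.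
    rewrite (eq_bigr (fun x : n.-tuple bool =>
      (9 / 8) ^+ nb_rigid n (fun z => f z == q) x))%R; last first.
      by move=> x /eqP fx; rewrite /u fx.
    exact: sum_expr_nb_rigid.
  have l0 : (0 <= l)%R by apply: le_trans l1.
  have Ble : (B%:R * l ^+ T <= \sum_x l ^+ u x)%R.
    rewrite [leRHS](bigID [pred x | T < u x]) /= -[leLHS]addr0 lerD //; last first.
      by apply: sumr_ge0 => x _; rewrite exprn_ge0.
    rewrite mulr_natl -sumr_const; apply: ler_sum => x Tx.
    by rewrite ler_weXn2l // ltnW.
  (* Here [8 * (s + 10) <= 2 * T]. Once [2 ^ s] cancels, [2 ^ 10 = 32 ^ 2] remains and gives
     [B32]. *)
  have two_le : (2 ^+ (s + 10) <= (l ^+ T) ^+ 2)%R.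
    apply: (@le_trans _ _ ((l ^+ 8) ^+ (s + 10))%R).
      by rewrite lerXn2r ?nnegrE ?exprn_ge0.
    by rewrite -!exprM ler_weXn2l //; lia.
  have : (B%:R ^+ 2 * 2 ^+ (s + 10) <= 2 ^+ s * (2 ^+ n * 2 ^+ n) :> rat)%R.
    apply: (@le_trans _ _ ((B%:R * l ^+ T) ^+ 2)%R).
      by rewrite exprMn ler_wpM2l ?sqr_ge0.
    apply: (@le_trans _ _ ((\sum_x l ^+ u x) ^+ 2)%R).
      by rewrite lerXn2r ?nnegrE ?mulr_ge0 ?ler0n ?exprn_ge0 // (le_trans _ Ble) //
        mulr_ge0 ?ler0n ?exprn_ge0.
    by apply: le_trans Sle _; rewrite !natrM !natrX.
  rewrite exprD mulrCA ler_pM2l ?exprn_gt0 // -!natrX -!natrM ler_nat => h.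
  by rewrite -(@leq_exp2r _ _ 2) // expnMn -(mulnn (2 ^ n)); apply: leq_trans h; rewrite mulnC.
have : \sum_x u x <= \sum_(x : n.-tuple bool) (T + n * (T < u x)).
  apply: leq_sum => x _; case: ltnP => [_|]; last by lia.
  rewrite muln1; apply: leq_trans (leq_addl _ _).
  rewrite -[leqRHS]card_ord -sum1_card; apply: leq_sum => k _; exact: leq_b1.
rewrite big_split /= sum_nat_const card_tuple card_bool -big_distrr /=.
have -> : \sum_(x : n.-tuple bool) (T < u x) = B.
  by rewrite /B -sum1_card [RHS]big_mkcond; apply: eq_bigr => x _; rewrite inE; case: ltnP.
have := leq_mul (leqnn n) B32.
rewrite [32 * B]mulnC mulnA [n * 2 ^ n]mulnC.
have -> : 2 ^ n * n = 2 ^ n * T * 32 by rewrite nT; ring.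
move: (n * B) (2 ^ n * T) => b c; rewrite /u; lia.
Qed.

(** Markov's inequality: a class counted on the left has density of [E] at least [1 / c]. In the sum
    of these densities over all [x], each [z] in [E] contributes the size of its class times the
    inverse of that size. *)
Lemma card_heavy_class (T : finType) (S : eqType) (f : T -> S) (E : pred T) c :
  \sum_x (\sum_z (f z == f x) <= c * \sum_z ((f z == f x) && E z)) <= c * \sum_x E x.
Proof.
rewrite -(ler_nat rat) natr_sum.
pose d x : rat := (\sum_z (f z == f x))%N%:R%R.
have d0 x : (0 < d x)%R by rewrite ltr0n (bigD1 x) //= eqxx.
apply: (@le_trans _ _ (\sum_x c%:R * ((\sum_z ((f z == f x) && E z))%N%:R / d x))%R).
  apply: ler_sum => x _; case: leqP => [h|_] /=.
    by rewrite mulrA ler_pdivlMr // mul1r -natrM ler_nat.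
  by rewrite mulr_ge0 ?divr_ge0 ?ler0n.
rewrite -mulr_sumr natrM ler_wpM2l ?ler0n //.
rewrite (eq_bigr (fun x => \sum_z ((f z == f x) && E z)%:R / d x)%R); last first.
  by move=> x _; rewrite natr_sum mulr_suml.
rewrite exchange_big /= natr_sum; apply: ler_sum => z _.
case: (E z); last by rewrite big1 // => x _; rewrite andbF mul0r.
rewrite (eq_bigr (fun x => (f z == f x)%:R / d z)%R); last first.
  by move=> x _; rewrite andbT; case: eqP => [e|]; rewrite ?mul0r // /d e.
rewrite -mulr_suml -natr_sum /d.
under eq_bigr do rewrite eq_sym.
by rewrite mulfV // lt0r_neq0 // d0.
Qed.

Lemma sum_prod (A B : finType) (F : A * B -> nat) :
  \sum_p F p = \sum_a \sum_b F (a, b).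
Proof. by rewrite pair_bigA; apply: eq_bigr => -[]. Qed.

(** * Resampling one coordinate of a configuration *)

Section Update.
Variables (I V : finType).
Implicit Type om : {ffun I -> V}.

Definition upd om i v : {ffun I -> V} := [ffun j => if j == i then v else om j].

Lemma upd_upd om i v w : upd (upd om i v) i w = upd om i w.
Proof. by apply/ffunP => j; rewrite !ffunE; case: eqP. Qed.

(** Exchanging [om i] with the fresh value [v] is an involution, so resampling preserves the uniform
    law. *)
Lemma sum_upd (g : {ffun I -> V} -> nat) i :
  \sum_om \sum_v g (upd om i v) = #|V| * \sum_om g om.
Proof.
rewrite pair_big /=.
rewrite (reindex_inj (h := fun p : {ffun I -> V} * V => (upd p.1 i p.2, p.1 i))) /=.
  rewrite -(pair_big predT predT (fun om v => g (upd (upd om i v) i (om i)))) /=.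
  rewrite big_distrr /=; apply: eq_bigr => om _.
  rewrite (eq_bigr (fun _ => g om)) ?sum_nat_const // => v _; congr g.
  by apply/ffunP => j; rewrite !ffunE; case: eqP => [->|].
apply: (@inv_inj _ (fun p : {ffun I -> V} * V => (upd p.1 i p.2, p.1 i))).
move=> [om v] /=; congr (_, _); last by rewrite ffunE eqxx.
by apply/ffunP => j; rewrite !ffunE; case: eqP => [->|].
Qed.

Lemma leq_sum_upd (g h : {ffun I -> V} -> nat) i : 0 < #|V| ->
  (forall om, \sum_v g (upd om i v) <= \sum_v h (upd om i v)) ->
  \sum_om g om <= \sum_om h om.
Proof.
by move=> V0 gh; rewrite -(leq_pmul2l V0) -!(sum_upd _ i) leq_sum.
Qed.

End Update.

(** * Deterministic block algorithms *)

(** Give [None] weight [n] and each [Some] weight 1: a coordinate has total weight [2 * n], and a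
    code with at least [h] entries [None] weighs at least [n ^ h]. *)
Lemma card_sparse_code (I : finType) n h : #|I| = 2 * h ->
  #|[pred c : {ffun I -> option 'I_n} | \sum_i (c i != None) <= h]| * n ^ h
  <= (2 * n) ^ #|I|.
Proof.
move=> Ih; pose wt (o : option 'I_n) := if o is None then n else 1.
have -> : (2 * n) ^ #|I| = \sum_(c : {ffun I -> option 'I_n}) \prod_i wt (c i).
  rewrite -(bigA_distr_bigA (fun _ => wt)) /= prod_nat_const; congr (_ ^ _).
  rewrite (bigD1 None) //= (eq_bigr (fun _ => 1)); last by case.
  by rewrite sum1_card cardC1 card_option card_ord mul2n addnn.
rewrite -sum_nat_const big_mkcond /=; apply: leq_sum => c _; case: ifP => //.
rewrite inE => ch.
rewrite [leqRHS](_ : _ = n ^ \sum_i (c i == None)); last first.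
  by rewrite expn_sum; apply: eq_bigr => i _; case: (c i) => [k|] /=; rewrite ?expn0 ?expn1.
have : h <= \sum_i (c i == None).
  have : \sum_i (c i == None) + \sum_i (c i != None) = 2 * h.
    by rewrite -big_split /= -Ih -sum1_card; apply: eq_bigr => i _; case: eqP.
  by move=> e; rewrite -(leq_add2r h) addnn -mul2n -e leq_add2l.
case: n wt c ch => [|n] wt c ch le_h; last exact: leq_pexp2l.
have -> : \sum_i (c i == None) = \sum_(i : I) 1.
  by apply: eq_bigr => i _; case: (c i) => [[]|].
by rewrite sum1_card Ih; case: h {ch le_h Ih} => // h; rewrite exp0n.
Qed.

Section Blocks.
Variables (Q : finType) (n m' : nat).
Local Notation m := m'.+1.
Local Notation config := {ffun 'I_m -> n.-tuple bool * 'I_n}.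
Variables (q0 : Q) (alpha beta : nat -> Q -> seq bool -> Q).
Variable dec : Q -> seq (seq bool) -> bool.
Implicit Types (om : config) (X W : nat -> seq bool).

(** [alpha j] reads the push of [X j], and [beta j] the pop and re-push that claim the letters
    [W j]. [dec] receives the words because the final pops spell them out. *)
Fixpoint state X W j : Q :=
  if j is j'.+1 then beta j' (alpha j' (state X W j') (X j')) (W j') else q0.

Lemma eq_state X W X' W' j :
  (forall i, i < j -> X i = X' i) -> (forall i, i < j -> W i = W' i) ->
  state X W j = state X' W' j.
Proof.
elim: j => //= j IH eX eW; rewrite eX // eW // IH // => i ij.
  by rewrite eX // ltnW.
by rewrite eW // ltnW.
Qed.

Lemma eq_state_merge X W X' W' i j :
  (forall l, l < j -> l != i -> X l = X' l) ->
  (forall l, l < j -> W l = W' l) ->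
  alpha i (state X W i) (X i) = alpha i (state X W i) (X' i) ->
  state X W j = state X' W' j.
Proof.
elim: j => //= j IH eX eW eA.
rewrite eW // -IH //; last 2 first.
- by move=> l lj; apply: eX; rewrite ltnW.
- by move=> l lj; apply: eW; rewrite ltnW.
by have [->|ji] := eqVneq j i; [rewrite eA | rewrite eX].
Qed.

(* Words are listed from the top of the stack, i.e. in the order in which they
   are popped.  For [m <= j], [inord j] is [0] and [word om j] is junk. *)
Definition word om j : seq bool := (om (inord j)).1.
Definition depth om j : nat := (om (inord j)).2.
Definition right_cut om j := take (depth om j).+1 (word om j).
Definition wrong_cut om j :=
  rcons (take (depth om j) (word om j)) (~~ nth false (word om j) (depth om j)).
Definition cut_wrong_at i om j := if j == i then wrong_cut om j else right_cut om j.

Definition final om := state (word om) (right_cut om) m.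
Definition final_wrong i om := state (word om) (cut_wrong_at i om) m.
Definition words om := mkseq (word om) m.
Definition err_yes om := ~~ dec (final om) (words om).
Definition err_no i om := dec (final_wrong i om) (words om).

Definition fiber om (i : nat) : pred (seq bool) := fun z =>
  alpha i (state (word om) (right_cut om) i) z
  == alpha i (state (word om) (right_cut om) i) (word om i).

(** Conditionally on the memory after push [i], the top [k] letters of word [i] and all the rest of
    [om], [E] has probability at least 1/32. *)
Definition heavy (E : pred config) k (i : 'I_m) om :=
  \sum_(z : n.-tuple bool) cyl (fiber om i) k (word om i) z
  <= 32 * \sum_(z : n.-tuple bool)
       (cyl (fiber om i) k (word om i) z && E (upd om i (z, (om i).2))).

Definition stuck om (i : nat) := rigid n (fiber om i) (depth om i) (word om i).

(** Comparing two configurations uses [err_no] at the own cut of the deeper one, but [err_yes] of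
    the other at that same, arbitrary depth. Hence the quantifier over [k], which costs a factor
    [n]. *)
Definition good om :=
  [&& [forall i : 'I_m, ~~ heavy (err_no i) (depth om i) i om],
      [forall i : 'I_m, [forall k : 'I_n, ~~ heavy err_yes k i om]]
    & 2 * \sum_(i < m) stuck om i <= m].

Lemma word_upd om (i : 'I_m) v j : j < m ->
  word (upd om i v) j = if j == i then tval v.1 else word om j.
Proof.
move=> jm; rewrite /word ffunE.
have -> : (inord j == i) = (j == i) by rewrite -(inj_eq val_inj) /= inordK.
by case: ifP.
Qed.

Lemma depth_upd om (i : 'I_m) v j : j < m ->
  depth (upd om i v) j = if j == i then v.2 : nat else depth om j.
Proof.
move=> jm; rewrite /depth ffunE.
have -> : (inord j == i) = (j == i) by rewrite -(inj_eq val_inj) /= inordK.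
by case: ifP.
Qed.

Lemma state_upd om (i : 'I_m) v :
  state (word (upd om i v)) (right_cut (upd om i v)) i
  = state (word om) (right_cut om) i.
Proof.
have lt j : j < i -> j < m by move=> ji; apply: ltn_trans (ltn_ord i).
by apply: eq_state => j ji; rewrite /right_cut !word_upd ?depth_upd ?lt // ltn_eqF.
Qed.

Lemma fiber_upd om (i : 'I_m) v z :
  fiber (upd om i v) i z =
  (alpha i (state (word om) (right_cut om) i) z
   == alpha i (state (word om) (right_cut om) i) v.1).
Proof. by rewrite /fiber state_upd word_upd ?ltn_ord // eqxx. Qed.

Lemma size_word om j : size (word om j) = n. Proof. exact: size_tuple. Qed.

Lemma depth_lt om j : depth om j < n. Proof. exact: ltn_ord. Qed.

(** The claim that is right for the old word is exactly the wrong claim for [z], which flips the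
    letter at the cut. *)
Lemma final_wrong_upd om (i : 'I_m) (z : n.-tuple bool) :
  cyl (fiber om i) (depth om i) (word om i) z ->
  flipped (depth om i) (word om i) z ->
  final_wrong i (upd om i (z, (om i).2)) = final om.
Proof.
move=> /andP[/eqP eA /eqP eT] fl.
have di : ((om i).2 : nat) = depth om i by rewrite /depth inord_val.
symmetry; apply: (@eq_state_merge _ _ _ _ i) => [l lm li|l lm|].
- by rewrite word_upd // (negPf li).
- rewrite /cut_wrong_at /wrong_cut /right_cut word_upd // depth_upd //.
  have [->|//] := eqVneq l i; rewrite /= di (take_nth false) ?size_word ?depth_lt //.
  rewrite eT; congr rcons; move: fl; rewrite /flipped.
  by case: (nth _ _ _); case: (nth _ _ _).
- by rewrite word_upd ?ltn_ord // eqxx /= eA.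
Qed.

(** The claim ends above depth [k], where [z] and the old word agree. *)
Lemma final_upd om (i : 'I_m) (z : n.-tuple bool) k :
  cyl (fiber om i) k (word om i) z -> depth om i < k ->
  final (upd om i (z, (om i).2)) = final om.
Proof.
move=> /andP[/eqP eA /eqP eT] dk.
have di : ((om i).2 : nat) = depth om i by rewrite /depth inord_val.
symmetry; apply: (@eq_state_merge _ _ _ _ i) => [l lm li|l lm|].
- by rewrite word_upd // (negPf li).
- rewrite /right_cut word_upd // depth_upd //.
  have [->|//] := eqVneq l i; rewrite /= di.
  by rewrite -(@take_takel _ _ k) // -eT take_takel.
- by rewrite word_upd ?ltn_ord // eqxx /= eA.
Qed.

(* A string that the memory cannot tell from the pushed word, and that first
   differs from it at the deeper cut, must be rejected because of the deeper
   cut and accepted because of the shallower one. *)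
Lemma good_depth_le om om' (i : 'I_m) :
  good om -> good om' -> (forall j, j < m -> word om j = word om' j) ->
  (forall j, j < i -> depth om j = depth om' j) -> final om = final om' ->
  ~~ stuck om i -> depth om i <= depth om' i.
Proof.
move=> /and3P[/forallP/(_ i) gn _ _] /and3P[_ /forallP/(_ i) gy _] eX eK eF st.
rewrite leqNgt; apply/negP => lt_d.
have lt j : j < i -> j < m by move=> ji; apply: ltn_trans (ltn_ord i).
have eS : state (word om) (right_cut om) i = state (word om') (right_cut om') i.
  by apply: eq_state => j ji; rewrite /right_cut ?eK ?eX ?lt.
have eC : cyl (fiber om' i) (depth om i) (word om' i) =
          cyl (fiber om i) (depth om i) (word om i).
  by apply: funext => z; rewrite /cyl /fiber eS eX.
move/forallP/(_ (Ordinal (depth_lt om i))): gy; rewrite /heavy /= eC -!ltnNge.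
move: gn st; rewrite /stuck /rigid /heavy -ltnNge -leqNgt.
rewrite -/(pcount n (cyl (fiber om i) (depth om i) (word om i))).
set r := pcount _ _; set en := \sum_z _; set f := pcount _ _; set ey := \sum_z _.
move=> hn hf hy.
(* Each error set has less than 1/32 of the cylinder and the flipped strings at least 1/16, so some
   flipped string avoids both errors. *)
have : en + ey < f by lia.
rewrite ltnNge => /negP; apply.
rewrite /en /ey /f -big_split /= /pcount; apply: leq_sum => z _.
case cz: (cyl (fiber om i) (depth om i) (word om i) z) => //=.
case fz: (flipped (depth om i) (word om i) z) => //=.
rewrite /err_no /err_yes.
have eWz : words (upd om i (z, (om i).2)) = words (upd om' i (z, (om' i).2)).
  apply/eq_in_map => j; rewrite mem_iota /= => jm; rewrite !word_upd //.
  by case: ifP => // _; rewrite eX.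
rewrite final_wrong_upd // (@final_upd om' i z (depth om i)) ?eC // eWz eF.
by case: (dec _ _).
Qed.

Lemma card_config : #|{: config}| = (2 ^ n * n) ^ m.
Proof. by rewrite card_ffun card_prod card_tuple card_bool !card_ord. Qed.

(** [dep] is the identity for the own cut and constant for a fixed depth. Word [i] is resampled with
    its cut kept, and [card_heavy_class] is applied to the classes of equal memory and equal top
    letters. *)
Lemma sum_heavy_le (E : pred config) (dep : 'I_n -> nat) (i : 'I_m) : 0 < n ->
  \sum_(om : config) heavy E (dep (om i).2) i om <= 32 * \sum_(om : config) E om.
Proof.
move=> n0; rewrite big_distrr /=; apply: (leq_sum_upd (i := i)) => [|om].
  by rewrite card_prod card_tuple card_bool card_ord muln_gt0 expn_gt0.
rewrite !sum_prod exchange_big [leqRHS]exchange_big /=; apply: leq_sum => k _.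
pose f (z : n.-tuple bool) :=
  (alpha i (state (word om) (right_cut om) i) z, take (dep k) z).
apply: leq_trans (_ : 32 * \sum_(x : n.-tuple bool) E (upd om i (x, k)) <= _); last first.
  by rewrite big_distrr.
apply: leq_trans (card_heavy_class f (fun x => E (upd om i (x, k))) 32).
apply: leq_sum => x _; rewrite /heavy ffunE eqxx /=.
have cE (z : n.-tuple bool) : cyl (fiber (upd om i (x, k)) i) (dep k)
    (word (upd om i (x, k)) i) z = (f z == f x).
  by rewrite /cyl fiber_upd word_upd ?ltn_ord // eqxx /= xpair_eqE.
rewrite (eq_bigr (fun z => nat_of_bool (f z == f x))); last by move=> z _; rewrite cE.
rewrite [X in _ <= 32 * X](eq_bigr (fun z =>
  nat_of_bool ((f z == f x) && E (upd om i (z, k))))) // => z _.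
by rewrite cE upd_upd.
Qed.

(** A uniform cut is stuck with probability the fraction of rigid letters, on average at most
    1/16. *)
Lemma sum_stuck_le (i : 'I_m) s T :
  #|Q| <= 2 ^ s -> 4 * s + 40 <= T -> n = 32 * T ->
  16 * \sum_(om : config) stuck om i <= #|{: config}|.
Proof.
move=> Qs sT nT.
have V0 : 0 < #|{: n.-tuple bool * 'I_n}|.
  by rewrite card_prod card_tuple card_bool card_ord muln_gt0 expn_gt0; lia.
rewrite -(leq_pmul2l V0) mulnCA -(sum_upd _ i) big_distrr [leqRHS]mulnC -sum_nat_const /=.
rewrite [leqRHS](eq_bigl predT) //; apply: leq_sum => om _.
rewrite sum_prod card_prod card_tuple card_bool card_ord.
pose f := alpha i (state (word om) (right_cut om) i).
apply: leq_trans (sum_rigid_le f Qs sT nT).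
rewrite leq_mul2l /=; apply: leq_sum => x _; apply: leq_sum => k _.
rewrite /stuck depth_upd ?word_upd ?ltn_ord // eqxx /=.
by rewrite (_ : fiber _ _ = (fun z => f z == f x)) //; apply: funext => z; rewrite fiber_upd.
Qed.

(** The heavy events exclude at most 32/128 of the configurations, and Markov's inequality gives at
    most 1/8 with more than half of the cuts stuck. *)
Lemma card_good_ge s T :
  #|Q| <= 2 ^ s -> 4 * s + 40 <= T -> n = 32 * T ->
  128 * (\sum_(i < m) \sum_(om : config) err_no i om + m * n * \sum_(om : config) err_yes om)
    <= #|{: config}| ->
  #|{: config}| <= 2 * #|good|.
Proof.
move=> Qs sT nT err_le.
have n0 : 0 < n by lia.
pose bad_no := \sum_(om : config) \sum_(i < m) heavy (err_no i) (depth om i) i om.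
pose bad_yes := \sum_(om : config) \sum_(i < m) \sum_(k < n) heavy err_yes k i om.
pose bad_stuck := #|[pred om : config | m < 2 * \sum_(i < m) stuck om i]|.
have b1 : bad_no <= 32 * \sum_(i < m) \sum_(om : config) err_no i om.
  rewrite /bad_no exchange_big big_distrr /=; apply: leq_sum => i _.
  apply: leq_trans (sum_heavy_le (err_no i) (fun k => k : nat) i n0).
  by apply: leq_sum => om _; rewrite /depth inord_val.
have b2 : bad_yes <= 32 * (m * n * \sum_(om : config) err_yes om).
  rewrite /bad_yes exchange_big /=.
  rewrite [leqRHS](_ : _ = \sum_(i < m) \sum_(k < n) (32 * \sum_(om : config) err_yes om)); last first.
    by rewrite !sum_nat_const !card_ord; ring.
  apply: leq_sum => i _; rewrite exchange_big /=; apply: leq_sum => k _.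
  exact: (sum_heavy_le err_yes (fun _ => k : nat) i n0).
have b3 : 8 * bad_stuck <= #|{: config}|.
  have : 16 * \sum_(om : config) \sum_(i < m) stuck om i <= m * #|{: config}|.
    rewrite exchange_big big_distrr /= -[X in X * _]card_ord -sum_nat_const.
    by apply: leq_sum => i _; exact: sum_stuck_le Qs sT nT.
  have : m * bad_stuck <= 2 * \sum_(om : config) \sum_(i < m) stuck om i.
    rewrite /bad_stuck mulnC -sum_nat_const big_mkcond big_distrr /=.
    by apply: leq_sum => om _; rewrite inE; case: ifP => // /ltnW.
  by rewrite -(leq_pmul2l (ltn0Sn m')); nia.
have : #|{: config}| <= #|good| + (bad_no + bad_yes + bad_stuck).
  rewrite -!sum1_card [X in _ <= X + _]big_mkcond /bad_stuck.
  rewrite -sum1_card [X in _ <= _ + (_ + _ + X)]big_mkcond /= /bad_no /bad_yes -!big_split /=.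
  apply: leq_sum => om _; rewrite !inE unfold_in /good.
  case: (boolP [forall _, _]) => [_|/forallPn[i]]; last first.
    rewrite negbK => hi; apply: leq_trans (leq_addl _ _); rewrite -addnA.
    by apply: leq_trans (leq_addr _ _); rewrite (bigD1 i) //= hi.
  case: (boolP [forall _, _]) => [_|/forallPn[i /forallPn[k]]]; last first.
    rewrite negbK => hik; apply: leq_trans (leq_addl _ _); rewrite addnAC.
    by apply: leq_trans (leq_addl _ _); rewrite (bigD1 i) //= (bigD1 k) //= hik.
  by case: (leqP (2 * \sum_(i < m) stuck om i) m) => _ /=; rewrite ?addn1 ?addnS.
lia.
Qed.

(* By [good_depth_le], the cuts omitted from the code can be recovered from the
   words and the final memory. *)
Definition code om : {ffun 'I_m -> option 'I_n} :=
  [ffun i : 'I_m => if stuck om i then Some (om i).2 else None].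

Lemma good_inj : {in good &,
  injective (fun om : config => ([ffun i : 'I_m => (om i).1] : {ffun 'I_m -> n.-tuple bool}, final om, code om))}.
Proof.
move=> om om' g g' [eX eF eC].
have {}eX i : (om i).1 = (om' i).1 by move/ffunP/(_ i): eX; rewrite !ffunE.
have eW j : word om j = word om' j by rewrite /word eX.
have eD j : j < m -> depth om j = depth om' j.
  elim/ltn_ind: j => j IH jm.
  have {}IH l : l < j -> depth om l = depth om' l.
    by move=> lj; apply: IH => //; apply: ltn_trans jm.
  have := congr1 (fun c : {ffun 'I_m -> option 'I_n} => c (Ordinal jm)) eC.
  rewrite !ffunE /=.
  (* Equal codes are stuck at the same places. A stuck cut is written in the code, any other is
     squeezed by [good_depth_le] in both directions. *)
  case: (boolP (stuck om j)) => sj; case: (boolP (stuck om' j)) => sj' //.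
    by rewrite /depth (_ : inord j = Ordinal jm); [case=> -> | apply: val_inj; rewrite /= inordK].
  move=> _; apply/eqP; rewrite eqn_leq.
  rewrite (@good_depth_le om om' (Ordinal jm)) //=.
  by rewrite (@good_depth_le om' om (Ordinal jm)) //= => l lj; rewrite IH.
apply/ffunP => i; have := eD i (ltn_ord i).
rewrite /depth !inord_val => /val_inj eK.
by move: (eX i) eK; case: (om i) (om' i) => [? ?] [? ?] /= -> ->.
Qed.

Lemma card_good_le h : m = 2 * h -> #|good| * n ^ h <= (2 ^ n) ^ m * #|Q| * (2 * n) ^ m.
Proof.
move=> mh.
have := @card_sparse_code 'I_m n h; rewrite card_ord => /(_ mh) code_le.
apply: leq_trans (leq_mul (leqnn _) code_le).
rewrite mulnA leq_mul2r; apply/orP; right.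
rewrite -(card_in_imset good_inj).
set C := [pred c : {ffun _ -> _} | _].
rewrite [X in _ <= X](_ : _ =
    #|[predX (predX (@predT {ffun 'I_m -> n.-tuple bool}) (@predT Q)) & C]|); last first.
  by rewrite !cardX !cardT -!cardE card_ffun card_tuple card_bool card_ord.
apply: subset_leq_card; apply/fintype.subsetP => _ /imsetP[om /and3P[_ _ g] ->].
rewrite !inE /=.
rewrite -(leq_pmul2l (isT : 0 < 2)) -mh; apply: leq_trans g.
rewrite leq_mul2l; apply: leq_sum => i _; rewrite ffunE.
by case: (stuck om i).
Qed.

Theorem memory_lower_bound s T h :
  #|Q| <= 2 ^ s -> 4 * s + 40 <= T -> n = 32 * T -> m = 2 * h ->
  128 * (\sum_(i < m) \sum_(om : config) err_no i om + m * n * \sum_(om : config) err_yes om)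
    <= #|{: config}| ->
  n ^ h <= 2 * 2 ^ s * 2 ^ m.
Proof.
move=> Qs sT nT mh err_le.
have := card_good_ge Qs sT nT err_le; have := card_good_le mh.
have n0 : 0 < n by lia.
rewrite card_config !expnMn => gle gge.
rewrite -(@leq_pmul2l ((2 ^ n) ^ m * n ^ m)) ?muln_gt0 ?expn_gt0 ?n0 //.
apply: leq_trans (leq_mul gge (leqnn _)) _; rewrite -mulnA.
apply: leq_trans (leq_mul (leqnn 2) gle) _.
apply: leq_trans (leq_mul (leqnn 2) (leq_mul (leq_mul (leqnn _) Qs) (leqnn _))) _.
by rewrite leq_eqVlt; apply/orP; left; apply/eqP; ring.
Qed.

End Blocks.

(** * Words in DYCK(2) *)

Definition opening (b : bool) := if b then open_a else open_b.
Definition closing (b : bool) := if b then close_a else close_b.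

Fixpoint reduces (st : seq bool) (u : seq letter) : bool :=
  match u with
  | [::] => st == [::]
  | open_a :: u' => reduces (true :: st) u'
  | open_b :: u' => reduces (false :: st) u'
  | close_a :: u' => if st is true :: st' then reduces st' u' else false
  | close_b :: u' => if st is false :: st' then reduces st' u' else false
  end.

Lemma reduces_opening st x u :
  reduces st (map opening x ++ u) = reduces (rev x ++ st) u.
Proof.
elim: x st => //= b x IH st; rewrite rev_cons cat_rcons -IH.
by case: b.
Qed.

Lemma reduces_closing st x u :
  reduces st (map closing x ++ u) = prefix x st && reduces (drop (size x) st) u.
Proof.
elim: x st => [|b x IH] [|c st] //=; first by case: b.
by case: b; case: c; rewrite /= ?IH //= eqseqE /=.
Qed.

Lemma dyck2_reduces u : dyck2 u -> forall st v, reduces st (u ++ v) = reduces st v.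
Proof. by elim=> //= {}u v _ IHu _ IHv st w; rewrite -catA IHu /= IHv. Qed.

Lemma cat_cons_split (T : Type) (c : T) x y u v : x ++ c :: y = u ++ v ->
  (exists2 x', x = u ++ x' & v = x' ++ c :: y) \/
  (exists2 y', u = x ++ c :: y' & y = y' ++ v).
Proof.
elim: x u => [|a x IH] [|b u] /=.
- by move=> <-; left; exists [::].
- by case=> <- e; right; exists u.
- by move=> <-; left; exists (a :: x).
- by case=> <- /IH[[x' -> ->]|[y' -> ->]]; [left; exists x'|right; exists y'].
Qed.

(** Needed for [reduces_dyck2], where a pop undoes an adjacent matched pair. By induction on the
    derivation, the insertion point is in front, inside the first factor, or inside the second. *)
Lemma dyck2_insert b u v : dyck2 (u ++ v) -> dyck2 (u ++ opening b :: closing b :: v).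
Proof.
have wrap w x y : dyck2 x -> dyck2 y -> dyck2 (opening w :: x ++ closing w :: y).
  by case: w; [exact: dyck2_a | exact: dyck2_b].
have nested c x y : dyck2 x -> dyck2 y ->
    (forall u v, x = u ++ v -> dyck2 (u ++ opening b :: closing b :: v)) ->
    (forall u v, y = u ++ v -> dyck2 (u ++ opening b :: closing b :: v)) ->
    forall u v, opening c :: x ++ closing c :: y = u ++ v ->
    dyck2 (u ++ opening b :: closing b :: v).
  move=> dx dy IHx IHy [|l u'] v' /=.
    by move=> <-; apply: (wrap b [::]); [exact: dyck2_nil | apply: wrap].
  case=> <- {l} e.
  case: (cat_cons_split e) => [[x' ex ->]|[y' -> ey]].
    by have := wrap c _ _ (IHx _ _ ex) dy; rewrite -catA.
  by have := wrap c _ _ dx (IHy _ _ ey); rewrite -catA.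
move: (erefl (u ++ v)); move: {1 3}(u ++ v) => w e d.
elim: d u v e => {w} [u v|x y dx IHx dy IHy u v|x y dx IHx dy IHy u v].
- by case: u v => [|? ?] [|? ?] // _; apply: (wrap b [::] [::]); exact: dyck2_nil.
- by apply: (nested true x y).
- by apply: (nested false x y).
Qed.

Lemma reduces_dyck2 st u : reduces st u -> dyck2 (map opening (rev st) ++ u).
Proof.
elim: u st => [|l u IH] st /=; first by move=> /eqP->; exact: dyck2_nil.
have push b : reduces (b :: st) u -> dyck2 (map opening (rev st) ++ opening b :: u).
  by move/IH; rewrite rev_cons map_rcons cat_rcons.
have pop b st' : reduces st' u ->
    dyck2 (map opening (rev (b :: st')) ++ closing b :: u).
  by move/IH/(dyck2_insert b); rewrite rev_cons map_rcons cat_rcons.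
case: l => [|||]; [exact: push true| |exact: push false|].
  by case: st {push IH} => [|[] st'] //; exact: pop true st'.
by case: st {push IH} => [|[] st'] //; exact: pop false st'.
Qed.

Lemma dyck2E u : dyck2 u <-> reduces [::] u.
Proof.
split=> [/dyck2_reduces/(_ [::] [::])|/reduces_dyck2 //].
by rewrite cats0 => ->.
Qed.

Definition padding r := flatten (nseq r [:: open_a; close_a]).

Lemma size_padding r : size (padding r) = r.*2.
Proof. by elim: r => //= r ->; rewrite doubleS. Qed.

Lemma reduces_padding st r u : reduces st (padding r ++ u) = reduces st u.
Proof. by elim: r. Qed.

(** * The hard inputs *)

Section Mountains.
Variable n : nat.
Implicit Types X W : nat -> seq bool.

(* The padding makes the length of a block independent of the cut, so that the
   position of the next block is known. *)
Definition descent (w : seq bool) : seq letter :=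
  map closing w ++ map opening (rev w) ++ padding (n - size w).

Definition ascents X W j : seq letter :=
  flatten (mkseq (fun i => map opening (rev (X i)) ++ descent (W i)) j).

Definition final_descent (xs : seq (seq bool)) r : seq letter :=
  flatten (map (map closing) (rev xs)) ++ padding r.

Definition mountains m X W r : seq letter :=
  ascents X W m ++ final_descent (mkseq X m) r.

Lemma ascentsS X W j :
  ascents X W j.+1 = ascents X W j ++ map opening (rev (X j)) ++ descent (W j).
Proof. by rewrite /ascents mkseqS flatten_rcons. Qed.

Lemma size_descent w : size w <= n -> size (descent w) = n.*2.
Proof.
by move=> wn; rewrite !size_cat !size_map size_rev size_padding; lia.
Qed.

Lemma size_ascents X W j :
  (forall i, i < j -> size (X i) = n) -> (forall i, i < j -> size (W i) <= n) ->
  size (ascents X W j) = 3 * n * j.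
Proof.
elim: j => [|j IH] sX sW; first by rewrite muln0.
rewrite ascentsS 2!size_cat size_descent ?sW // size_map size_rev sX // IH; first lia.
  by move=> i ij; rewrite sX // ltnW.
by move=> i ij; rewrite sW // ltnW.
Qed.

Lemma size_mountains m X W r :
  (forall i, i < m -> size (X i) = n) -> (forall i, i < m -> size (W i) <= n) ->
  size (mountains m X W r) = 4 * n * m + r.*2.
Proof.
move=> sX sW; rewrite size_cat size_ascents // size_cat size_padding.
have -> : size (flatten (map (map closing) (rev (mkseq X m)))) = n * m.
  elim: m sX {sW} => [|m IH] sX; first by rewrite muln0.
  rewrite mkseqS rev_rcons /= size_cat size_map sX // mulnS IH // => i im.
  by rewrite sX // ltnW.
lia.
Qed.

(** The size bound keeps the pops inside [x]; if they match, the re-push restores the stack. *)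
Lemma reduces_ascent st x w u : size w <= size x ->
  reduces st ((map opening (rev x) ++ descent w) ++ u) =
  prefix w x && reduces (x ++ st) u.
Proof.
move=> wx; rewrite /descent -!catA reduces_opening revK reduces_closing.
rewrite reduces_opening revK reduces_padding.
have -> : prefix w (x ++ st) = prefix w x by rewrite !prefixE takel_cat.
case: (boolP (prefix w x)) => //= /prefixP[y ->].
by rewrite -catA drop_size_cat.
Qed.

Lemma reduces_ascents X W j u :
  (forall i, i < j -> size (W i) <= size (X i)) ->
  reduces [::] (ascents X W j ++ u) =
  all (fun i => prefix (W i) (X i)) (iota 0 j) &&
    reduces (flatten (rev (mkseq X j))) u.
Proof.
elim: j u => [//|j IH] u sW; rewrite ascentsS -catA IH => [|i ij]; last first.
  by rewrite sW // ltnW.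
rewrite reduces_ascent ?sW // mkseqS rev_rcons -addn1 iotaD all_cat /=.
by rewrite andbT andbA.
Qed.

Lemma dyck2_mountains m X W r :
  (forall i, i < m -> size (W i) <= size (X i)) ->
  dyck2 (mountains m X W r) <-> (forall i, i < m -> prefix (W i) (X i)).
Proof.
move=> sW; rewrite dyck2E reduces_ascents // /final_descent.
have -> xs : reduces (flatten xs) (flatten (map (map closing) xs) ++ padding r).
  rewrite -[padding r]cats0; elim: xs => [|x xs IH] /=; first by rewrite reduces_padding.
  by rewrite -catA reduces_closing prefix_prefix drop_size_cat.
rewrite andbT; split=> [/allP h i im|h]; first by apply: h; rewrite mem_iota.
by apply/allP => i; rewrite mem_iota => /h.
Qed.

End Mountains.

(** * A streaming algorithm with fixed coins as a block algorithm *)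

Section Run.
Variables (R : realType) (s : nat) (A : stream_alg R s) (w : coins A) (n m : nat).

Lemma run_cat i q u v : run w i q (u ++ v) = run w (i + size u) (run w i q u) v.
Proof.
elim: u i q => [|a u IH] i q /=; first by rewrite addn0.
by rewrite IH addnS.
Qed.

(** A block has [n] letters of push and [2 * n] of descent, so its position depends on [j] alone. *)
Definition run_ascent j q (x : seq bool) := run w (3 * n * j) q (map opening (rev x)).
Definition run_descent j q (c : seq bool) := run w (3 * n * j + n) q (descent n c).
Definition final_accept r q xs := accept w (run w (3 * n * m) q (final_descent xs r)).

Lemma run_ascents X W j :
  (forall i, i < j -> size (X i) = n) -> (forall i, i < j -> size (W i) <= n) ->
  run w 0 (init w) (ascents n X W j) =
  state (init w) run_ascent run_descent X W j.
Proof.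
elim: j => [//|j IH] sX sW.
have sX' i : i < j -> size (X i) = n by move=> ij; rewrite sX // ltnW.
have sW' i : i < j -> size (W i) <= n by move=> ij; rewrite sW // ltnW.
by rewrite ascentsS run_cat IH // run_cat size_ascents // size_map size_rev sX.
Qed.

Lemma decision_mountains X W r :
  (forall i, i < m -> size (X i) = n) -> (forall i, i < m -> size (W i) <= n) ->
  decision w (mountains n m X W r) =
  final_accept r (state (init w) run_ascent run_descent X W m) (mkseq X m).
Proof. by move=> sX sW; rewrite /decision run_cat run_ascents // size_ascents. Qed.

End Run.

(** * Averaging over the coins *)

(** First moment: the expected number of events that occur is at most [#|I| * e]. *)
Lemma exists_few_events (R : realType) d (T : measurableType d) (P : probability T R)
    (I : finType) (E : I -> set T) (e : R) (c : nat) :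
  (forall i, measurable (E i)) -> (forall i, (P (E i) <= e%:E)%E) ->
  (#|I|%:R * e < c%:R)%R ->
  exists w, \sum_i (w \in E i) < c.
Proof.
move=> mE PE Ic; apply: contrapT => /forallNP many.
have : (c%:R%:E <= \int[P]_(w in setT) (\sum_i (\1_(E i) w)%:E))%E.
  rewrite -[leLHS]mule1 -(@probability_setT _ _ _ P) -integral_cst //.
  apply: ge0_le_integral => //.
  - by move=> w _; rewrite lee_fin.
  - apply: emeasurable_sum => i; apply/measurable_EFinP.
    exact: measurable_indic.
  - move=> w _; rewrite sumEFin lee_fin -natr_sum ler_nat leqNgt.
    exact/negP/many.
rewrite ge0_integral_sum //; last first.
  by move=> i; apply/measurable_EFinP; exact: measurable_indic.
apply/negP; rewrite -ltNge.
apply: (@le_lt_trans _ _ (#|I|%:R * e)%:E); last by rewrite lte_fin.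
rewrite mulr_natl -sumr_const -sumEFin; apply: lee_sum => i _.
by rewrite integral_indic // setIT; exact: PE.
Qed.

Section Measurability.
Variables (R : realType) (s : nat) (A : stream_alg R s).

Lemma measurable_run u i q r : measurable [set w : coins A | run w i q u = r].
Proof.
elim: u i q => [|a u IH] i q /=.
  have [->|qr] := eqVneq q r.
    by rewrite (_ : mkset _ = setT) //; apply/seteqP; split.
  by rewrite (_ : mkset _ = set0) //; apply/seteqP; split => // w /eqP; rewrite (negPf qr).
rewrite (_ : mkset _ = \bigcup_(p in [set: s.-tuple bool])
    ([set w : coins A | step w i q a = p] `&` [set w | run w i.+1 p u = r]))%classic.
  apply: fin_bigcup_measurable => [|p _]; first exact: finite_finset.
  by apply: measurableI; [exact: measurable_step | exact: IH].
apply/seteqP; split=> w /=; first by move=> h; exists (step w i q a).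
by case=> p _ [/= -> ->].
Qed.

Lemma measurable_decision u : measurable [set w : coins A | decision w u].
Proof.
rewrite (_ : mkset _ = \bigcup_(q in [set: s.-tuple bool])
   ([set w : coins A | init w = q] `&` \bigcup_(r in [set: s.-tuple bool])
    ([set w : coins A | run w 0 q u = r] `&` [set w | accept w r])))%classic.
  apply: fin_bigcup_measurable => [|q _]; first exact: finite_finset.
  apply: measurableI; first exact: measurable_init.
  apply: fin_bigcup_measurable => [|r _]; first exact: finite_finset.
  by apply: measurableI; [exact: measurable_run | exact: measurable_accept].
apply/seteqP; split=> w /=.
  by move=> h; exists (init w) => //; split=> //; exists (run w 0 (init w) u).
by case=> q _ [/= eq [r _ [/= er]]]; rewrite /decision eq er.
Qed.

Lemma measurable_error u : measurable [set w : coins A | ~ (decision w u <-> dyck2 u)].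
Proof.
have [du|du] := pselect (dyck2 u).
  rewrite (_ : mkset _ = ~` [set w : coins A | decision w u])%classic.
    by apply: measurableC; exact: measurable_decision.
  by apply/seteqP; split=> w /= h h'; apply: h; [split | exact: h'.2].
rewrite (_ : mkset _ = [set w : coins A | decision w u])%classic.
  exact: measurable_decision.
apply/seteqP; split=> w /=; last by move=> h [/(_ h)].
by move=> h; apply: contrapT => h'; apply: h; split.
Qed.

End Measurability.

Theorem stream_lower_bound (R : realType) (s : nat) (A : stream_alg R s) (N : nat) (e : R)
    T n m' h r :
  dyck2_error_le A N e -> 4 * s + 40 <= T -> n = 32 * T -> m'.+1 = 2 * h ->
  N = 4 * n * m'.+1 + r.*2 -> (128 * (m'.+1 + m'.+1 * n)%:R * e <= 1)%R ->
  n ^ h <= 2 * 2 ^ s * 2 ^ m'.+1.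
Proof.
set m := m'.+1 => err sT nT mh NE e_le.
pose config : finType := {ffun 'I_m -> n.-tuple bool * 'I_n}.
(* Each correct input is repeated for every pair (word, cut), giving it the weight [m * n] required
   by [memory_lower_bound]. *)
pose I : finType := (('I_m + 'I_m * 'I_n) * config)%type.
pose cuts (p : I) := match p with
  | (inl i, om) => cut_wrong_at i om | (inr _, om) => right_cut om end.
pose input (p : I) := mountains n m (word p.2) (cuts p) r.
have sW (om : config) i : i < m -> size (word om i) = n by rewrite size_word.
have sC p i : i < m -> size (cuts p i) <= n.
  have sR (om : config) : size (right_cut om i) <= n.
    by rewrite size_take_min size_word geq_minr.
  move=> _; case: p => -[j|jk] om /=; last exact: sR.
  rewrite /cut_wrong_at; case: eqP => // _.
  by rewrite size_rcons size_take_min (leq_ltn_trans (geq_minl _ _)) // depth_lt.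
have sI p : size (input p) = N by rewrite size_mountains // => i; [exact: sW|exact: sC].
pose inp p : N.-tuple letter := Tuple (introT eqP (sI p)).
have Ic : (#|I|%:R * e < (#|config| %/ 128).+1%:R)%R.
  rewrite card_prod card_sum card_prod !card_ord natrM.
  apply: (@le_lt_trans _ _ (#|config|%:R / 128)%R).
    rewrite ler_pdivlMr ?ltr0n //.
    rewrite [leLHS](_ : _ = #|config|%:R * (128 * (m + m * n)%:R * e))%R; last by ring.
    by rewrite -[leRHS]mulr1 ler_wpM2l.
  by rewrite ltr_pdivrMr ?ltr0n // -natrM ltr_nat ltn_ceil.
have [w few] := exists_few_events (fun p => measurable_error A (inp p))
  (fun p => err (inp p)) Ic.
move: few; rewrite ltnS => few.
pose alpha := run_ascent w n; pose beta := run_descent w n.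
pose dec := final_accept w n m r.
apply: (@memory_lower_bound _ n m' (init w) alpha beta dec s T h) => //.
  by rewrite card_tuple card_bool.
apply: leq_trans (leq_divM #|config| 128); rewrite mulnC leq_mul2r /=.
apply: leq_trans few.
have dE p : decision w (inp p) =
    dec (state (init w) alpha beta (word p.2) (cuts p) m) (words p.2).
  by rewrite /= decision_mountains // => i; [exact: sW|exact: sC].
have in_lang p : dyck2 (inp p) <-> (forall i, i < m -> prefix (cuts p i) (word p.2 i)).
  by rewrite /= dyck2_mountains // => i im; rewrite sW // sC.
have right om i : prefix (right_cut om i) (word om i) :> bool by exact: prefix_take.
have wrong (om : config) i : prefix (wrong_cut om i) (word om i) = false.
  rewrite /wrong_cut prefixE size_rcons size_takel ?size_word ?(ltnW (depth_lt _ _)) //.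
  rewrite (take_nth false) ?size_word ?depth_lt // eqseq_rcons eqxx /=.
  by case: (nth _ _ _).
pose bad p := w \in [set w | ~ (decision w (inp p) <-> dyck2 (inp p))]%classic.
rewrite -[leqRHS]/(\sum_p bad p).
have bad_no (i : 'I_m) (om : config) : err_no (init w) alpha beta dec i om -> bad (inl i, om).
  move=> acc; rewrite /bad inE /= => -[+ _]; rewrite dE => /(_ acc)/in_lang.
  by move=> /(_ i (ltn_ord i)); rewrite /= /cut_wrong_at eqxx wrong.
have bad_yes (jk : 'I_m * 'I_n) (om : config) : err_yes (init w) alpha beta dec om -> bad (inr jk, om).
  move=> rej; rewrite /bad inE /= => -[_]; rewrite dE => acc.
  by move: rej; rewrite /err_yes acc //; apply/in_lang => i _; exact: right.
rewrite sum_prod big_sumType /= leq_add //.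
  by apply: leq_sum => i _; apply: leq_sum => om _; case: (err_no _ _ _ _ _ _) (bad_no i om) => // ->.
have -> : m * n = #|{: 'I_m * 'I_n}| by rewrite card_prod !card_ord.
rewrite -sum_nat_const [leqLHS](eq_bigl predT) //.
apply: leq_sum => jk _; apply: leq_sum => om _.
by case: (err_yes _ _ _ _ _) (bad_yes jk om) => // ->.
Qed.

(** * Asymptotics *)

Lemma sqr_interval (a N : nat) : 0 < a -> {h | a * h ^ 2 <= N < a * h.+1 ^ 2}.
Proof.
move=> a0; have ex : exists h, a * h ^ 2 <= N by exists 0; rewrite muln0.
have bd h : a * h ^ 2 <= N -> h <= N by nia.
case: (ex_maxnP ex bd) => h hN hmax; exists h; rewrite hN ltnNge.
by apply/negP => /hmax; rewrite ltnn.
Qed.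

(** Take [m = 2 * h], [T = L * h] and [n = 32 * T], so that [4 * n * m = 256 * L * h ^ 2] nearly
    fills [N]. If [4 * s + 40 <= T], then [n ^ 2 >= 2 ^ L] contradicts
    [n ^ h <= 2 ^ (s + 1 + 2 * h)]. *)
Lemma space_gt (R : realType) (s : nat) (A : stream_alg R s) (N : nat) (e : R) :
  dyck2_error_le A N e -> ~~ odd N -> 12 <= trunc_log 2 N -> (64 * N%:R * e <= 1)%R ->
  {h | trunc_log 2 N * h < 4 * s + 40 & 0 < h /\ N <= 1024 * trunc_log 2 N * h ^ 2}.
Proof.
move=> err evN L12 eN; set L := trunc_log 2 N in L12 *.
have N0 : 0 < N by rewrite lt0n; apply: contraTneq L12 => N0; rewrite /L N0 trunc_log0.
have LN : 2 ^ L <= N by rewrite trunc_logP.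
have [|h /andP[hN Nh]] := @sqr_interval (256 * L) N; first by lia.
have L256 : 256 * L <= 2 ^ L.
  rewrite -(subnK L12) expnD [2 ^ 12](_ : _ = 256 * 16)//.
  have := ltn_expl (L - 12) (isT : 1 < 2).
  move: (2 ^ (L - 12)) => p; nia.
have h0 : 0 < h by case: h hN Nh => [|//] _; nia.
have Nle : N <= 1024 * L * h ^ 2 by nia.
exists h; last by [].
rewrite ltnNge; apply/negP => sT.
pose m' := (2 * h).-1; pose n := 32 * (L * h).
have mE : m'.+1 = 2 * h by rewrite prednK // muln_gt0.
(* The remaining length is even, so padding pairs fill it. *)
have NE : N = 4 * n * m'.+1 + ((N - 256 * L * h ^ 2)./2).*2.
  have -> : 4 * n * m'.+1 = 256 * L * h ^ 2 by rewrite mE /n; ring.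
  rewrite even_halfK ?subnKC // oddB // (negPf evN) -mulnA oddM //.
have e0 : (0 <= e)%R.
  by have := err [tuple of nseq N open_a]; rewrite -lee_fin; exact: le_trans.
have e_le : (128 * (m'.+1 + m'.+1 * n)%:R * e <= 1)%R.
  apply: le_trans eN; rewrite ler_wpM2r // -!natrM ler_nat.
  have : 0 < L * h by rewrite muln_gt0 h0 andbT; lia.
  rewrite {1}NE mE /n; move: (L * h) => p p0.
  by have := leq_pmulr h p0; lia.
have := stream_lower_bound err sT (erefl n) mE NE e_le.
apply/negP; rewrite -ltnNge mE -expnS -expnD.
have n2 : 2 ^ L <= n ^ 2.
  rewrite (leq_trans LN) // (leq_trans Nle) //.
  have -> : n ^ 2 = 1024 * L * h ^ 2 * L by rewrite /n; ring.
  by rewrite leq_pmulr //; lia.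
rewrite -(@ltn_exp2r _ _ 2) // -expnM [_ * 2]mulnC -[X in _ < X]expnM [h * 2]mulnC.
rewrite (expnM n 2 h); apply: (@leq_trans ((2 ^ L) ^ h)); last by rewrite leq_exp2r.
by rewrite -expnM ltn_exp2l //; have := leq_mul L12 (leqnn h); lia.
Qed.

Lemma ln_natr_le (R : realType) N : 0 < N -> (ln N%:R <= (trunc_log 2 N).+1%:R :> R)%R.
Proof.
move=> N0.
apply: (@le_trans _ _ (ln ((2 ^+ (trunc_log 2 N).+1) : R)))%R.
  rewrite ler_ln ?posrE ?ltr0n ?exprn_gt0 // -natrX ler_nat ltnW //.
  exact: trunc_log_ltn.
rewrite lnXn //; apply: ler_wMn2r.
by have := @le_ln1Dx R 1; rewrite (_ : 1 + 1 = 2)%R //; apply; lra.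
Qed.

Unset Implicit Arguments.

Local Open Scope classical_set_scope.
Local Open Scope ring_scope.

(** No word of odd length is in the language, so rejecting is always correct there; hence the
    restriction to even lengths. *)
Theorem corollary1 (R : realType) (s : nat -> nat)
    (A : forall n : nat, stream_alg R (s n)) (eps : nat -> R^o)
    (error_A : forall n : nat, dyck2_error_le (A n) n (eps n))
    (eps_bigO : eps =O_\oo (fun n : nat => (n%:R * ln n%:R)^-1 : R^o)) :
  (fun n : nat => (s n)%:R : R^o)
    =Omega_(within [set n | ~~ odd n] \oo)
    (fun n : nat => Num.sqrt (n%:R * ln n%:R) : R^o).
Proof.
move/eqO_exP : eps_bigO => [C C0 eps_le].
(* With [L] the binary logarithm, [N ln N <= 2048 * (L * h) ^ 2 <= 2048 * (8 * s) ^ 2 <= (400 * s) ^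
   2]. *)
rewrite eqOmegaE eqOmegaO; apply/eqO_exP; exists 400%:R; first by rewrite ltr0n.
rewrite near_withinE; near=> N => evN.
(* This absorbs the additive 40: [80 <= L * h < 4 * s + 40] yields [L * h <= 8 * s]. *)
have L80 : (80 <= trunc_log 2 N)%N.
  by apply: trunc_log_max => //; near: N; exact: nbhs_infty_ge.
have N0 : (0 < N)%N by case: (N) L80 => //; rewrite trunc_log0.
(* Then [64 * N * eps N <= 64 * C / ln N <= 1]. *)
have lnN : expR (64 * C) <= N%:R.
  by near: N; exact: nbhs_infty_ger.
have lnC : 64 * C <= ln N%:R by rewrite -ler_expR lnK // posrE ltr0n.
have ln0 : 0 < ln N%:R :> R by apply: lt_le_trans lnC; rewrite mulr_gt0.
have eN : 64 * N%:R * eps N <= 1.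
  have : `|eps N| <= C * `|(N%:R * ln N%:R)^-1| by near: N.
  rewrite [`|(_)^-1|]ger0_norm ?invr_ge0 ?mulr_ge0 ?ler0n ?(ltW ln0) // => h.
  have {h} := le_trans (ler_norm _) h.
  rewrite -(ler_pM2l (_ : 0 < 64 * N%:R)) ?mulr_gt0 ?ltr0n // => /le_trans; apply.
  rewrite invfM.
  rewrite [leLHS](_ : _ = 64 * C / ln N%:R); first by rewrite ler_pdivrMr ?mul1r.
  by field; rewrite !gt_eqF ?ltr0n.
have [|h Lh [h0 Nh]] := space_gt (@error_A N) evN _ eN; first exact: leq_trans L80.
rewrite ger0_norm ?sqrtr_ge0 // ger0_norm ?ler0n //.
have Ls : (trunc_log 2 N * h <= 8 * s N)%N.
  have : (80 <= trunc_log 2 N * h)%N by apply: (leq_trans L80); rewrite leq_pmulr.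
  lia.
rewrite -(@ler_pXn2r _ 2) ?nnegrE ?sqrtr_ge0 ?mulr_ge0 ?ler0n //.
rewrite sqr_sqrtr ?mulr_ge0 ?ler0n ?(ltW ln0) //.
apply: (@le_trans _ _ ((1024 * trunc_log 2 N * h ^ 2)%N%:R * (2 * trunc_log 2 N)%N%:R)).
  apply: ler_pM; rewrite ?ler0n ?(ltW ln0) ?ler_nat //.
  apply: le_trans (ln_natr_le R N0) _; rewrite ler_nat; lia.
rewrite -[400]/(400%:R) -natrM -natrM -natrX ler_nat.
have := leq_mul Ls Ls; nia.
Unshelve. all: by end_near.
Qed.
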